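(* Let $\mathbb F$ be an arbitrary field; all algebras are over $\mathbb F$. (a) Suppose $L_0$ is a simple IAC algebra and $\ell\geq 1$ is an integer. Then the direct sum $L=(L_0)^{\oplus\ell}$ is an IAC algebra. Further, if $L_0$ is non-abelian, then $L=(L_0)^{\oplus\ell}$ has precisely $\ell$ minimal ideals, namely the given direct summands, and in particular $\mathrm{Aut}(L)=\mathrm{Aut}(L_0)\wr\mathsf S_\ell$. (b) Let $L$ be an IAC algebra of finite dimension. Then $L\cong I^{\oplus\ell}$ for some simple IAC subalgebra $I$ of $L$ and some $\ell\geq 1$. Further, if $L$ is non-abelian, then $\ell$ is the number of minimal ideals of $L$.
   Context: An anti-commutative algebra over a field is a (not necessarily associative) algebra, with product written $\llbracket x,y\rrbracket$, satisfying $\llbracket x,x\rrbracket=0$ for all $x$. It is IAC if in addition its automorphism group $\mathrm{Aut}(L)$ acts irreducibly on the vector space $L$. The algebra is abelian if all products are zero. It is simple if it is non-zero and its only ideals are $0$ and itself (so a one-dimensional abelian algebra counts as simple). $\mathsf S_\ell$ is the symmetric group of degree $\ell$, and the wreath product $\mathrm{Aut}(L_0)\wr\mathsf S_\ell$ acts on $(L_0)^{\oplus\ell}$ with the base group acting componentwise and $\mathsf S_\ell$ permuting the summands. *)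

(* Defs.v *)
From HB Require Import structures.
From mathcomp Require Import all_boot all_order all_fingroup all_algebra.
From mathcomp Require Import all_classical.

Set Implicit Arguments.
Unset Strict Implicit.
Unset Printing Implicit Defensive.

Import GRing.Theory.

Local Open Scope ring_scope.
Local Open Scope classical_set_scope.

HB.mixin Record Lmodule_isAnticommAlg (F : fieldType) L of GRing.Lmodule F L := {
  bracket : L -> L -> L;
  bracket_linearl : forall y, linear (fun x => bracket x y);
  bracket_linearr : forall x, linear (bracket x);
  bracketxx : forall x, bracket x x = 0
}.

#[short(type="anticommAlgType")]
HB.structure Definition AnticommAlg (F : fieldType) :=
  {L of GRing.Lmodule F L & Lmodule_isAnticommAlg F L}.

#[short(type="finDimAnticommAlgType")]
HB.structure Definition FinDimAnticommAlg (F : fieldType) :=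
  {L of Vector F L & Lmodule_isAnticommAlg F L}.

Notation "⟦ x , y ⟧" := (bracket x y) (at level 0, format "⟦ x ,  y ⟧").

Section Notions.
Variable F : fieldType.

Definition is_subspace (V : lmodType F) (W : set V) : Prop :=
  W 0 /\ forall (a : F) x y, W x -> W y -> W (a *: x + y).

Definition irreducible_action (V : lmodType F) (G : Type)
    (act : G -> V -> V) : Prop :=
  (exists x : V, x != 0) /\
  forall W : set V, is_subspace W -> (forall g x, W x -> W (act g x)) ->
    W = [set 0] \/ W = setT.

Section Algebra.
Variable L : anticommAlgType F.

Definition abelian_alg : Prop := forall x y : L, ⟦x, y⟧ = 0.

Definition is_ideal (I : set L) : Prop :=
  is_subspace I /\ forall x y, I x -> I ⟦x, y⟧ /\ I ⟦y, x⟧.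

Definition simple_alg : Prop :=
  (exists x : L, x != 0) /\
  forall I : set L, is_ideal I -> I = [set 0] \/ I = setT.

Definition minimal_ideal (I : set L) : Prop :=
  [/\ is_ideal I, I <> [set 0] &
      forall J : set L, is_ideal J -> J <> [set 0] -> J `<=` I -> J = I].

Definition is_algaut (f : L -> L) : Prop :=
  [/\ linear f, {morph f : x y / ⟦x, y⟧} & bijective f].

Record algaut := AlgAut { algaut_fun :> L -> L; algautP : is_algaut algaut_fun }.

Definition IAC : Prop := irreducible_action algaut_fun.

End Algebra.

Definition alg_isomorphic (A B : anticommAlgType F) : Prop :=
  exists f : A -> B,
    [/\ linear f, {morph f : x y / ⟦x, y⟧} & bijective f].

End Notions.

(* Products in [algaut L] are read from left to right, [(f * g) x = g (f x)], as
   for the permutations of MathComp. *)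
Section AutGroup.
Variables (F : fieldType) (L : anticommAlgType F).

HB.instance Definition _ := gen_eqMixin (algaut L).
HB.instance Definition _ := gen_choiceMixin (algaut L).

Lemma algaut_eq (f g : algaut L) : f =1 g -> f = g.
Proof.
case: f g => [f fP] [g gP] /= /funext fg.
by case: _ / fg in gP *; rewrite (Prop_irrelevance fP gP).
Qed.

Lemma algaut_bij (f : algaut L) : bijective f. Proof. by case: (algautP f). Qed.

Lemma is_algaut_id : is_algaut (@id L).
Proof. by split=> //; exists id. Qed.

Lemma is_algaut_comp (f g : algaut L) : is_algaut (fun x => g (f x)).
Proof.
have [[lf mf bf] [lg mg bg]] := (algautP f, algautP g).
by split; [move=> a x y; rewrite lf lg | move=> x y; rewrite mf mg |
           exact: bij_comp].
Qed.

Definition algaut_inv_fun (f : algaut L) : L -> L :=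
  projT1 (cid2 (let: Bijective g fK gK := algaut_bij f in
                ex_intro2 _ _ g fK gK)).

Lemma algaut_funK (f : algaut L) : cancel f (algaut_inv_fun f).
Proof. by rewrite /algaut_inv_fun; case: cid2. Qed.

Lemma algaut_inv_funK (f : algaut L) : cancel (algaut_inv_fun f) f.
Proof. by rewrite /algaut_inv_fun; case: cid2. Qed.

Lemma is_algaut_inv (f : algaut L) : is_algaut (algaut_inv_fun f).
Proof.
have [lf mf bf] := algautP f; have injf := bij_inj bf.
split.
- by move=> a x y; apply: injf; rewrite lf !algaut_inv_funK.
- by move=> x y; apply: injf; rewrite mf !algaut_inv_funK.
- by exists f; [exact: algaut_inv_funK | exact: algaut_funK].
Qed.

Definition algaut_one := AlgAut is_algaut_id.
Definition algaut_mul (f g : algaut L) := AlgAut (is_algaut_comp f g).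
Definition algaut_inv (f : algaut L) := AlgAut (is_algaut_inv f).

Lemma algaut_mulA : associative algaut_mul. Proof. by move=> *; apply: algaut_eq. Qed.
Lemma algaut_mul1 : left_id algaut_one algaut_mul.
Proof. by move=> *; apply: algaut_eq. Qed.
Lemma algaut_mulr1 : right_id algaut_one algaut_mul.
Proof. by move=> *; apply: algaut_eq. Qed.
Lemma algaut_mulV : left_inverse algaut_one algaut_inv algaut_mul.
Proof. by move=> f; apply: algaut_eq => x; apply: algaut_inv_funK. Qed.
Lemma algaut_mulrV : right_inverse algaut_one algaut_inv algaut_mul.
Proof. by move=> f; apply: algaut_eq => x; apply: algaut_funK. Qed.

HB.instance Definition _ := isGroup.Build (algaut L)
  algaut_mulA algaut_mul1 algaut_mulr1 algaut_mulV algaut_mulrV.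

End AutGroup.

Section DirectSum.
Variables (F : fieldType) (L0 : anticommAlgType F) (l : nat).

Definition ffun_bracket (x y : {ffun 'I_l -> L0}) : {ffun 'I_l -> L0} :=
  [ffun i => ⟦x i, y i⟧].

Lemma ffun_bracket_linearl y : linear (fun x => ffun_bracket x y).
Proof. by move=> a u v; apply/ffunP=> i; rewrite !ffunE bracket_linearl. Qed.

Lemma ffun_bracket_linearr x : linear (ffun_bracket x).
Proof. by move=> a u v; apply/ffunP=> i; rewrite !ffunE bracket_linearr. Qed.

Lemma ffun_bracketxx x : ffun_bracket x x = 0.
Proof. by apply/ffunP=> i; rewrite !ffunE bracketxx. Qed.

HB.instance Definition _ := Lmodule_isAnticommAlg.Build F {ffun 'I_l -> L0}
  ffun_bracket_linearl ffun_bracket_linearr ffun_bracketxx.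

Definition summand (i : 'I_l) : set {ffun 'I_l -> L0} :=
  [set x | forall j, j != i -> x j = 0].

End DirectSum.

(* [Wreath g s] stands for "first apply [g i] to the [i]th coordinate, then
   move the [i]th coordinate to position [s i]"; the product, again from left
   to right, is the one for which this is an action. *)
Section Wreath.
Variables (G : groupType) (l : nat).

Record wreath := Wreath {
  wreath_base : {ffun 'I_l -> G};
  wreath_top : 'S_l
}.

HB.instance Definition _ := gen_eqMixin wreath.
HB.instance Definition _ := gen_choiceMixin wreath.

Definition wreath_one : wreath := Wreath [ffun => 1%g] 1%g.
Definition wreath_mul (u v : wreath) : wreath :=
  Wreath [ffun i => wreath_base u i * wreath_base v (wreath_top u i)]%g
         (wreath_top u * wreath_top v)%g.
Definition wreath_inv (u : wreath) : wreath :=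
  Wreath [ffun i => (wreath_base u ((wreath_top u)^-1 i))^-1]%g
         (wreath_top u)^-1%g.

Lemma wreath_mulA : associative wreath_mul.
Proof.
move=> u v w; congr Wreath; last exact: mulgA.
by apply/ffunP=> i; rewrite !ffunE permM mulgA.
Qed.
Lemma wreath_mul1 : left_id wreath_one wreath_mul.
Proof.
move=> [g s]; congr Wreath; last exact: mul1g.
by apply/ffunP=> i; rewrite !ffunE perm1 mul1g.
Qed.
Lemma wreath_mulr1 : right_id wreath_one wreath_mul.
Proof.
move=> [g s]; congr Wreath; last exact: mulg1.
by apply/ffunP=> i; rewrite !ffunE mulg1.
Qed.
Lemma wreath_mulV : left_inverse wreath_one wreath_inv wreath_mul.
Proof.
move=> [g s]; congr Wreath; last exact: mulVg.
by apply/ffunP=> i; rewrite !ffunE mulVg.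
Qed.
Lemma wreath_mulrV : right_inverse wreath_one wreath_inv wreath_mul.
Proof.
move=> [g s]; congr Wreath; last exact: mulgV.
by apply/ffunP=> i; rewrite !ffunE /= permK mulgV.
Qed.

HB.instance Definition _ := isGroup.Build wreath
  wreath_mulA wreath_mul1 wreath_mulr1 wreath_mulV wreath_mulrV.

End Wreath.

Section WreathAction.
Variables (F : fieldType) (L0 : anticommAlgType F) (l : nat).

Definition wreath_act_fun (w : wreath (algaut L0) l) (x : {ffun 'I_l -> L0}) :
    {ffun 'I_l -> L0} :=
  [ffun i => let j := ((wreath_top w)^-1)%g i in wreath_base w j (x j)].

Lemma wreath_act_is_algaut w : is_algaut (wreath_act_fun w).
Proof.
split.
- move=> a x y; apply/ffunP=> i; rewrite !ffunE /= ?ffunE.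
  by case: (algautP (wreath_base w ((wreath_top w)^-1%g i))) => lf _ _; rewrite lf.
- move=> x y; apply/ffunP=> i; rewrite !ffunE /= ?ffunE.
  by case: (algautP (wreath_base w ((wreath_top w)^-1%g i))) => _ mf _; rewrite mf.
- pose h (y : {ffun 'I_l -> L0}) : {ffun 'I_l -> L0} :=
    [ffun i => (wreath_base w i)^-1%g (y (wreath_top w i))].
  exists h => x; apply/ffunP=> i; rewrite !ffunE /= ?ffunE.
  + by rewrite permK; apply: algaut_funK.
  + by rewrite permKV; apply: algaut_inv_funK.
Qed.

Definition wreath_act (w : wreath (algaut L0) l) : algaut {ffun 'I_l -> L0} :=
  AlgAut (wreath_act_is_algaut w).

End WreathAction.

Section Subalgebra.
Variables (F : fieldType) (L : finDimAnticommAlgType F).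

Record subalgebra := Subalgebra {
  subalg_vspace : {vspace L};
  subalg_closed : forall x y, x \in subalg_vspace -> y \in subalg_vspace ->
    ⟦x, y⟧ \in subalg_vspace
}.

Definition subalg_type (S : subalgebra) : Type := subvs_of (subalg_vspace S).

HB.instance Definition _ S := Vector.copy (subalg_type S)
  (subvs_of (subalg_vspace S)).

Variable S : subalgebra.

Definition subalg_bracket (x y : subalg_type S) : subalg_type S :=
  Subvs (subalg_closed (subvsP x) (subvsP y)).

Lemma subalg_bracket_linearl y : linear (fun x => subalg_bracket x y).
Proof. by move=> a u v; apply: val_inj; apply: bracket_linearl. Qed.

Lemma subalg_bracket_linearr x : linear (subalg_bracket x).
Proof. by move=> a u v; apply: val_inj; apply: bracket_linearr. Qed.

Lemma subalg_bracketxx x : subalg_bracket x x = 0.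
Proof. by apply: val_inj; apply: bracketxx. Qed.

HB.instance Definition _ := Lmodule_isAnticommAlg.Build F (subalg_type S)
  subalg_bracket_linearl subalg_bracket_linearr subalg_bracketxx.

End Subalgebra.

Coercion subalg_type : subalgebra >-> Sortclass.

(* Main.v *)
Require Import Defs.
From HB Require Import structures.
From mathcomp Require Import all_boot all_order all_fingroup all_algebra.
From mathcomp Require Import all_classical.

(* (a) Let W be a nonzero invariant subspace of L0^l and let x in W have a
   nonzero coordinate x_i. Subtracting from x its image under an automorphism of
   the i-th factor that moves x_i, or under a transvection when L0 is abelian,
   yields a nonzero element of W lying in a single summand, and irreducibility
   of Aut(L0) together with the coordinate permutations gives W = L0^l. If L0 is
   simple and non-abelian, its centre is 0, so bracketing shows that an ideal
   containing x contains every summand on which x is nonzero; hence the minimal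
   ideals are the summands, and every automorphism permutes them.

   (b) Let S be a minimal ideal of L, and choose automorphisms f_0, ..., f_(l-1)
   with l maximal such that (v_j) |-> sum_j f_j(v_j) is injective on S^l. By
   maximality and irreducibility this map is onto, and distinct summands f_j(S)
   annihilate each other, so it is an algebra isomorphism. If S is non-abelian
   and W is an Aut(S)-invariant subspace of S, then W^l is invariant under
   Aut(S) wr Sym(l) = Aut(S^l), so W is 0 or S. *)

Set Implicit Arguments.
Unset Strict Implicit.
Unset Printing Implicit Defensive.

Import GRing.Theory.

Local Open Scope ring_scope.
Local Open Scope classical_set_scope.
Local Open Scope card_scope.

(** * Linear maps known only by a linearity proof, and subspaces as sets *)

Section LinearFacts.
Variables (F : fieldType) (U V : lmodType F).

Section LinearMap.
Variables (f : U -> V) (lf : linear f).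

Let f' : {linear U -> V} := HB.pack f (GRing.isLinear.Build F U V *:%R f lf).

Lemma lin0 : f 0 = 0. Proof. exact: (raddf0 f'). Qed.
Lemma linD : {morph f : x y / x + y}. Proof. exact: (raddfD f'). Qed.
Lemma linZ a : {morph f : x / a *: x}. Proof. exact: (linearZ_LR f'). Qed.
Lemma linN : {morph f : x / - x}. Proof. exact: (raddfN f'). Qed.
Lemma linB : {morph f : x y / x - y}. Proof. exact: (raddfB f'). Qed.
Lemma lin_sum (J : Type) (r : seq J) (P : pred J) (E : J -> U) :
  f (\sum_(j <- r | P j) E j) = \sum_(j <- r | P j) f (E j).
Proof. exact: (raddf_sum f'). Qed.

Lemma lin_inj : (forall x, f x = 0 -> x = 0) -> injective f.
Proof.
move=> f0 x y fxy; apply/eqP; rewrite -subr_eq0; apply/eqP/f0.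
by rewrite linB fxy subrr.
Qed.

Lemma subspace_preimage (W : set V) : is_subspace W -> is_subspace (f @^-1` W).
Proof.
by move=> [W0 WD]; split=> [|a x y Wx Wy] /=; rewrite ?lin0 // lf; apply: WD.
Qed.

Lemma subspace_image (W : set U) : is_subspace W -> is_subspace (f @` W).
Proof.
move=> [W0 WD]; split=> [|a _ _ [x Wx <-] [y Wy <-]].
  by exists 0 => //; apply: lin0.
by exists (a *: x + y); [apply: WD | rewrite lf].
Qed.

End LinearMap.

Section Subspace.
Variables (W : set U) (sW : is_subspace W).

Lemma subspace0 : W 0. Proof. by case: sW. Qed.

Lemma subspaceD x y : W x -> W y -> W (x + y).
Proof. by move=> Wx Wy; rewrite -[x]scale1r; case: sW => _; apply. Qed.

Lemma subspaceN x : W x -> W (- x).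
Proof.
by move=> Wx; rewrite -scaleN1r -[_ *: x]addr0; case: sW => W0; apply.
Qed.

Lemma subspaceB x y : W x -> W y -> W (x - y).
Proof. by move=> Wx Wy; apply: subspaceD => //; apply: subspaceN. Qed.

Lemma subspace_sum (J : Type) (r : seq J) (P : pred J) (E : J -> U) :
  (forall j, W (E j)) -> W (\sum_(j <- r | P j) E j).
Proof.
move=> WE; elim/big_rec: _ => [|j y _]; first exact: subspace0.
exact: subspaceD.
Qed.

Lemma subspace_n0 : W <> [set 0] -> exists2 x, W x & x != 0.
Proof.
move=> WN0; apply: contrapT => nW; apply: WN0; apply/seteqP; split=> x /=.
  by move=> Wx; apply/eqP/negPn/negP => xN0; apply: nW; exists x.
by move=> ->; apply: subspace0.
Qed.

End Subspace.

Lemma subspace_line (x : U) : is_subspace [set y | exists a : F, y = a *: x].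
Proof.
split=> [|a y z [b ->] [c ->]] /=; first by exists 0; rewrite scale0r.
by exists (a * b + c); rewrite scalerDl scalerA.
Qed.

End LinearFacts.

(** * Ideals, transport along isomorphisms, and vectors moved by automorphisms *)

Section Ideals.
Variables (F : fieldType).
Implicit Types A B C : anticommAlgType F.

Lemma bracket0l A (y : A) : ⟦0, y⟧ = 0.
Proof. exact: (lin0 (bracket_linearl y)). Qed.

Lemma bracket0r A (x : A) : ⟦x, 0⟧ = 0.
Proof. exact: (lin0 (bracket_linearr x)). Qed.

Lemma bracketC A (x y : A) : ⟦x, y⟧ = - ⟦y, x⟧.
Proof.
apply/eqP; rewrite -subr_eq0 opprK -(bracketxx (x + y)).
rewrite (linD (bracket_linearl _)) !(linD (bracket_linearr _)).
by rewrite !bracketxx add0r addr0.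
Qed.

Lemma is_idealP A (I : set A) :
  is_subspace I -> (forall x y, I x -> I ⟦x, y⟧) -> is_ideal I.
Proof.
move=> sI Ibr; split=> // x y Ix; split; first exact: Ibr.
by rewrite bracketC; apply: subspaceN (Ibr _ _ Ix).
Qed.

(** The same condition as in [is_algaut] and [alg_isomorphic], so [algautP] also proves it for
    automorphisms. *)
Definition is_algiso A B (f : A -> B) : Prop :=
  [/\ linear f, {morph f : x y / ⟦x, y⟧} & bijective f].

Lemma algaut_linear A (f : algaut A) : linear f.
Proof. by have [] := algautP f. Qed.

Lemma algaut_bracket A (f : algaut A) :
  {morph f : x y / ⟦x, y⟧}.
Proof. by have [] := algautP f. Qed.

Lemma is_algiso_inv A B (f : A -> B) (g : B -> A) :
  is_algiso f -> cancel f g -> cancel g f -> is_algiso g.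
Proof.
move=> [lf mf bf] fK gK; have fI := bij_inj bf; split; last by exists f.
- by move=> a x y; apply: fI; rewrite lf !gK.
- by move=> x y; apply: fI; rewrite mf !gK.
Qed.

Lemma is_algiso_comp A B C (f : A -> B) (g : B -> C) :
  is_algiso f -> is_algiso g -> is_algiso (g \o f).
Proof.
move=> [lf mf bf] [lg mg bg]; split; last exact: bij_comp.
- by move=> a x y /=; rewrite lf lg.
- by move=> x y /=; rewrite mf mg.
Qed.

Lemma ideal_preimage A B (f : A -> B) (I : set B) :
  is_algiso f -> is_ideal I -> is_ideal (f @^-1` I).
Proof.
move=> [lf mf _] [sI Ibr]; apply: is_idealP; first exact: subspace_preimage.
by move=> x y Ix /=; rewrite mf; have [] := Ibr _ (f y) Ix.
Qed.

Lemma preimage_iso_n0 A B (f : A -> B) (I : set B) :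
  is_algiso f -> is_subspace I -> I <> [set 0] -> f @^-1` I <> [set 0].
Proof.
move=> [lf _ [g fK gK]] sI IN0 /seteqP[sub _].
have [x Ix /negP] := subspace_n0 sI IN0; apply.
by rewrite -(gK x) (_ : g x = 0) ?(lin0 lf) //; apply: sub; rewrite /= gK.
Qed.

Lemma minimal_ideal_preimage A B (f : A -> B) (I : set B) :
  is_algiso f -> minimal_ideal I -> minimal_ideal (f @^-1` I).
Proof.
move=> isof [iI IN0 Imin]; have [_ _ [g fK gK]] := isof.
have isog := is_algiso_inv isof fK gK.
have preK (J : set A) : f @^-1` (g @^-1` J) = J.
  by apply/seteqP; split=> x; rewrite /= fK.
split; [exact: ideal_preimage | exact: preimage_iso_n0 (proj1 iI) IN0 |].
move=> J iJ JN0 sJ; rewrite -[J]preK; congr (_ @^-1` _); apply: Imin.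
- exact: ideal_preimage.
- exact: preimage_iso_n0 (proj1 iJ) JN0.
- by move=> y /= /sJ /=; rewrite gK.
Qed.

(** Taking preimages under [f] is a bijection on minimal ideals, inverted by preimages under [g].
    This carries the count from a power to [L]. *)
Lemma card_minimal_ideal_iso A B (f : A -> B) : is_algiso f ->
  [set J : set A | minimal_ideal J] #= [set J : set B | minimal_ideal J].
Proof.
move=> isof; have [_ _ [g fK gK]] := isof.
have isog := is_algiso_inv isof fK gK.
have -> : [set J : set A | minimal_ideal J] =
    (fun J => f @^-1` J) @` [set J : set B | minimal_ideal J].
  apply/seteqP; split=> [J mJ|_ [J mJ <-]] /=; last first.
    exact: minimal_ideal_preimage.
  exists (g @^-1` J); first exact: minimal_ideal_preimage.
  by apply/seteqP; split=> x; rewrite /= fK.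
apply: inj_card_eq => I J _ _ IJ; apply/seteqP; split=> y.
  by rewrite -(gK y) -[X in X -> _]/((f @^-1` I) (g y)) IJ.
by rewrite -(gK y) -[X in X -> _]/((f @^-1` J) (g y)) -IJ.
Qed.

Lemma abelian_iso A B (f : A -> B) : is_algiso f ->
  abelian_alg B -> abelian_alg A.
Proof.
move=> [lf mf bf] abB x y; apply: (bij_inj bf).
by rewrite mf abB lin0.
Qed.

(** Conjugating an automorphism of [A] by [f] gives one of [B], so the preimage of an invariant
    subspace is invariant. *)
Lemma IAC_iso A B (f : A -> B) : is_algiso f -> IAC A -> IAC B.
Proof.
move=> isof [[x xN0] irrA]; have [lf _ [g fK gK]] := isof.
have isog := is_algiso_inv isof fK gK; have lg : linear g by case: isog.
split.
  exists (f x); apply: contra_neq xN0 => fx0.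
  by rewrite -(fK x) fx0 lin0.
move=> W sW Winv.
have [|W0|WT] := irrA (f @^-1` W) (subspace_preimage lf sW).
- move=> h z /= Wz; have isoh : is_algiso h := algautP h.
  have isof' := is_algiso_comp (is_algiso_comp isog isoh) isof.
  by have := Winv (AlgAut isof') _ Wz; rewrite /= fK.
- left; apply/seteqP; split=> y /=; last by move=> ->; case: sW.
  move=> Wy; rewrite -(gK y) (_ : g y = 0) ?lin0 //.
  by have /seteqP[sub _] := W0; apply: sub; rewrite /= gK.
- right; apply/seteqP; split=> y //= _.
  by rewrite -(gK y) -[W _]/((f @^-1` W) (g y)) WT.
Qed.

(** The centre is an ideal, and it can be the whole algebra only in the abelian case. *)
Lemma simple_center0 A (x : A) : simple_alg A -> ~ abelian_alg A ->
  (forall y, ⟦x, y⟧ = 0) -> x = 0.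
Proof.
move=> [_ simA] nab xZ.
have [|Z0|ZT] := simA [set z | forall y, ⟦z, y⟧ = 0].
- apply: is_idealP => [|z y zZ w] /=; last by rewrite zZ bracket0l.
  split=> [y|a u v uZ vZ y]; first exact: bracket0l.
  by rewrite bracket_linearl uZ vZ scaler0 addr0.
- by have /seteqP[sub _] := Z0; apply: sub.
- case: nab => u v.
  by have /seteqP[_ sub] := ZT; apply: (sub u).
Qed.

Lemma line_abelian A (x : A) : [set y | exists a : F, y = a *: x] = setT ->
  abelian_alg A.
Proof.
move=> /seteqP[_ sub] u v.
have [[a ->] [b ->]] := (sub u I, sub v I).
rewrite (linZ (bracket_linearl _)) (linZ (bracket_linearr _)).
by rewrite bracketxx !scaler0.
Qed.

(** When all products vanish, every subspace is an ideal. *)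
Lemma abelian_simple_IAC A : simple_alg A -> abelian_alg A -> IAC A.
Proof.
move=> [nz simA] ab; split=> // W sW _; apply: simA.
by apply: is_idealP => // x y _; rewrite ab; apply: subspace0.
Qed.

(** If all automorphisms fixed [x], the line through [x] would be invariant, hence the whole
    algebra, and an algebra spanned by one vector is abelian. *)
Lemma IAC_nonabelian_moved A (x : A) : IAC A -> ~ abelian_alg A -> x != 0 ->
  exists g : algaut A, g x != x.
Proof.
move=> [_ irrA] nab xN0; apply: contrapT => fixx.
have gx (g : algaut A) : g x = x.
  by apply/eqP/negPn/negP => gx; apply: fixx; exists g.
have [|/seteqP[sub _]|/line_abelian//] := irrA _ (subspace_line x).
  move=> g _ [a ->] /=; exists a; have [lg _ _] := algautP g.
  by rewrite (linZ lg) gx.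
by case/negP: xN0; apply/eqP; apply: sub; exists 1; rewrite scale1r.
Qed.

End Ideals.

(** * Powers of a simple algebra *)

Section PowerAlgebra.
Variables (F : fieldType) (L0 : anticommAlgType F) (l : nat).
Local Notation L := {ffun 'I_l -> L0}.

Definition inj_summand (i : 'I_l) (v : L0) : L :=
  [ffun j => if j == i then v else 0].

Lemma inj_summandE i v : inj_summand i v i = v.
Proof. by rewrite ffunE eqxx. Qed.

Lemma inj_summand_linear i : linear (inj_summand i).
Proof.
move=> a u v; apply/ffunP=> j; rewrite !ffunE.
by case: eqP; rewrite ?scaler0 ?addr0.
Qed.

Lemma inj_summand_eq0 i v : inj_summand i v = 0 -> v = 0.
Proof. by move=> v0; rewrite -(inj_summandE i v) v0 ffunE. Qed.

Lemma inj_summandK (x : L) : \sum_i inj_summand i (x i) = x.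
Proof.
apply/ffunP=> j; rewrite sum_ffunE (bigD1 j) //= inj_summandE.
rewrite big1 ?addr0 // => i.
by rewrite ffunE eq_sym => /negPf->.
Qed.

Lemma summandE i (x : L) : summand i x -> x = inj_summand i (x i).
Proof.
by move=> xi; apply/ffunP=> j; rewrite ffunE; case: eqP => [->|/eqP/xi].
Qed.

Lemma inj_summandP i v : summand i (inj_summand i v).
Proof. by move=> j /negPf ji; rewrite ffunE ji. Qed.

Lemma inj_summand_bracketl (x : L) i v :
  ⟦inj_summand i v, x⟧ = inj_summand i ⟦v, x i⟧.
Proof.
by apply/ffunP=> j; rewrite !ffunE; case: eqP => [->|]; rewrite ?bracket0l.
Qed.

Lemma inj_summand_bracketr (x : L) i v :
  ⟦x, inj_summand i v⟧ = inj_summand i ⟦x i, v⟧.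
Proof.
by apply/ffunP=> j; rewrite !ffunE; case: eqP => [->|]; rewrite ?bracket0r.
Qed.

Lemma inj_summand_bracket i u v :
  ⟦inj_summand i u, inj_summand i v⟧ = inj_summand i ⟦u, v⟧.
Proof. by rewrite inj_summand_bracketr inj_summandE. Qed.

Lemma summand_subspace i : is_subspace (@summand F L0 l i).
Proof.
split=> [j _|a x y xi yi j ji]; first by rewrite ffunE.
by rewrite !ffunE xi ?yi // scaler0 addr0.
Qed.

Lemma summand_ideal i : is_ideal (@summand F L0 l i).
Proof.
apply: is_idealP (summand_subspace i) _ => x y xi j ji.
by rewrite ffunE xi // bracket0l.
Qed.

Lemma subspace_powerT (W : set L) : is_subspace W ->
  (forall i, inj_summand i @^-1` W = setT) -> W = setT.
Proof.
move=> sW WT; apply/seteqP; split=> // x _; rewrite -(inj_summandK x).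
apply: subspace_sum => // i.
by rewrite -[W _]/((inj_summand i @^-1` W) (x i)) WT.
Qed.

(** * Irreducibility of the automorphism group of a power *)

Definition cst_wreath (g : algaut L0) : wreath (algaut L0) l :=
  Wreath [ffun => g] 1%g.

Lemma wreath_act_inj_summand w i v :
  wreath_act w (inj_summand i v) =
  inj_summand (wreath_top w i) (wreath_base w i v).
Proof.
(* Writing the index [j] as the image of some [k] under the permutation cancels the inverse in
   [wreath_act_fun]. *)
apply/ffunP=> j; rewrite -(permKV (wreath_top w) j).
move: ((wreath_top w)^-1%g j) => k.
rewrite !ffunE /= !permK ffunE (inj_eq perm_inj).
case: eqP => [->//|_].
by have [lg _ _] := algautP (wreath_base w k); rewrite lin0.
Qed.

(** The part of [W] in the [i]-th summand is invariant under [algaut L0] acting diagonally and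
    nonzero, so it is the full summand; transpositions then carry it to every other summand. *)
Lemma IAC_power_of_component (W : set L) i v : IAC L0 -> is_subspace W ->
  (forall g x, W x -> W (@wreath_act F L0 l g x)) ->
  W (inj_summand i v) -> v != 0 -> W = setT.
Proof.
move=> [_ irr0] sW Winv Wv vN0.
have sWi := subspace_preimage (@inj_summand_linear _) sW.
have inv_i (g : algaut L0) x : W (inj_summand i x) -> W (inj_summand i (g x)).
  by move=> /(Winv (cst_wreath g)); rewrite wreath_act_inj_summand perm1 ffunE.
have [W0|WiT] := irr0 _ (sWi i) inv_i.
  case/negP: vN0; apply/eqP.
  by rewrite -[_ = _]/([set 0] v) -W0.
apply: subspace_powerT => // j; apply/seteqP; split=> // u _.
have Wu : W (inj_summand i u) by rewrite -[W _]/((inj_summand i @^-1` W) u) WiT.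
have := Winv (Wreath [ffun => 1%g] (tperm i j)) _ Wu.
by rewrite wreath_act_inj_summand /= tpermL ffunE.
Qed.

Definition transvection (i j : 'I_l) (x : L) : L := x + inj_summand j (x i).

(** Brackets are preserved because all of them are 0. Since [i != j], the [i]-th coordinate is
    unchanged, so subtracting it again inverts the map. *)
Lemma transvection_algaut i j : i != j -> abelian_alg L0 ->
  is_algaut (transvection i j).
Proof.
move=> ij ab; split.
- move=> a x y; rewrite /transvection !ffunE inj_summand_linear scalerDr.
  by rewrite addrACA.
- by move=> x y; apply/ffunP=> k; rewrite !ffunE !ab; case: ifP; rewrite addr0.
- exists (fun x : L => x - inj_summand j (x i)) => x;
    by rewrite /transvection !ffunE (negPf ij) ?subr0 ?addr0 ?addrK ?subrK.
Qed.

Lemma IAC_power : (1 <= l)%N -> IAC L0 -> IAC L.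
Proof.
move=> l_gt0 iac0; split.
  have [[v vN0] _] := iac0; exists (inj_summand (Ordinal l_gt0) v).
  by apply: contra_neq vN0; apply: inj_summand_eq0.
move=> W sW Winv; have [|WN0] := EM (W = [set 0]); [by left | right].
have Wwr g x : W x -> W (wreath_act g x) by apply: Winv.
have [x Wx xN0] := subspace_n0 sW WN0.
have [i xiN0] : exists i, x i != 0.
  apply: contrapT => nex; case/eqP: xN0; apply/ffunP => i; rewrite ffunE.
  by apply/eqP/negPn/negP => ?; apply: nex; exists i.
have [ab|nab] := EM (abelian_alg L0).
  have [[j ij]|noj] := EM (exists j, i != j).
    have Wt := Winv (AlgAut (transvection_algaut ij ab)) _ Wx.
    apply: (@IAC_power_of_component W j (x i)) => //.
    rewrite (_ : inj_summand _ _ = transvection i j x - x).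
      exact: subspaceB.
    by rewrite /transvection addrC addKr.
  (* Here [i] is the only index, so [x] itself lies in the [i]-th summand. *)
  apply: (@IAC_power_of_component W i (x i)) => //.
  rewrite -summandE // => j ji; case: noj; exists j.
  by rewrite eq_sym.
(* [w] moves the [i]th coordinate only, so [w x - x] is a nonzero element of
   the [i]th summand. *)
have [g gxi] := IAC_nonabelian_moved iac0 nab xiN0.
pose w := Wreath [ffun k => if k == i then g else 1%g] 1%g.
apply: (@IAC_power_of_component W i (g (x i) - x i)) => //; last first.
  by rewrite subr_eq0.
rewrite (_ : inj_summand _ _ = wreath_act w x - x).
  by apply: subspaceB => //; apply: Wwr.
apply/ffunP => k; rewrite !ffunE /= invg1 perm1 ffunE.
by case: eqP => [->|_] //=; rewrite subrr.
Qed.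

(** * Minimal ideals of a power of a non-abelian simple algebra *)

Section NonabelianSimple.
Hypotheses (sim0 : simple_alg L0) (nab0 : ~ abelian_alg L0).

Lemma summand_n0 i : @summand F L0 l i <> [set 0].
Proof.
have [[v vN0] _] := sim0; move=> /seteqP[sub _]; case/negP: vN0; apply/eqP.
by apply: (@inj_summand_eq0 i); apply: sub; apply: inj_summandP.
Qed.

Lemma summand_inj : injective (@summand F L0 l).
Proof.
have [[v vN0] _] := sim0; move=> i j ij; apply/eqP/negPn/negP => nij.
have : summand j (inj_summand i v) by rewrite -ij; apply: inj_summandP.
by move=> /(_ i nij); rewrite inj_summandE => /eqP; apply/negP.
Qed.

(** The part of [I] in the [i]-th summand is an ideal of [L0]. It contains the brackets of [x i]
    with all [y], and one of these is nonzero because the centre is 0. *)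
Lemma ideal_contains_summand (I : set L) i x :
  is_ideal I -> I x -> x i != 0 -> summand i `<=` I.
Proof.
move=> [sI Ibr] Ix xiN0.
have [y xyN0] : exists y, ⟦x i, y⟧ != 0.
  apply: contrapT => nex; case/negP: xiN0; apply/eqP.
  apply: (simple_center0 sim0 nab0) => y.
  by apply/eqP/negPn/negP => ?; apply: nex; exists y.
have [_ irr0] := sim0.
have iIi : is_ideal (inj_summand i @^-1` I).
  apply: is_idealP (subspace_preimage (@inj_summand_linear i) sI) _ => u v /= Iu.
  by rewrite -inj_summand_bracket; apply: (proj1 (Ibr _ _ Iu)).
have Iixy : (inj_summand i @^-1` I) ⟦x i, y⟧.
  by rewrite /= -inj_summand_bracketr; apply: (proj1 (Ibr _ _ Ix)).
have [I0|IT] := irr0 _ iIi.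
  by case/negP: xyN0; apply/eqP; rewrite -[_ = _]/([set 0] _) -I0.
by move=> z /summandE->; rewrite -[I _]/((inj_summand i @^-1` I) (z i)) IT.
Qed.

Lemma ideal_summand (I : set L) : is_ideal I -> I <> [set 0] ->
  exists i, summand i `<=` I.
Proof.
move=> iI IN0; have [x Ix xN0] := subspace_n0 (proj1 iI) IN0.
apply: contrapT => nex; case/eqP: xN0; apply/ffunP => i; rewrite ffunE.
apply/eqP/negPn/negP => xiN0; apply: nex; exists i.
exact: ideal_contains_summand xiN0.
Qed.

Lemma minimal_idealsE :
  [set I : set L | minimal_ideal I] = range (@summand F L0 l).
Proof.
apply/seteqP; split=> [I [iI IN0 Imin]|_ [i _ <-]] /=.
  have [i sub] := ideal_summand iI IN0; exists i => //.
  by apply: Imin => //; [apply: summand_ideal | apply: summand_n0].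
split=> [||J iJ JN0 sJ]; [exact: summand_ideal | exact: summand_n0 |].
have [x Jx xN0] := subspace_n0 (proj1 iJ) JN0.
apply/seteqP; split=> //; apply: ideal_contains_summand (Jx) _ => //.
apply: contra_neq xN0 => xi0.
by rewrite (summandE (sJ _ Jx)) xi0 (lin0 (@inj_summand_linear i)).
Qed.

Lemma card_minimal_ideals : [set I : set L | minimal_ideal I] #= `I_l.
Proof.
rewrite minimal_idealsE.
apply: (card_eq_trans (inj_card_eq _)).
  by move=> i j _ _; apply: summand_inj.
by rewrite card_eq_sym; apply: card_II.
Qed.

(** * Identification of the automorphism group with the wreath product *)

Lemma wreath_act_morph : {morph @wreath_act F L0 l : u v / (u * v)%g}.
Proof.
move=> u v; apply: algaut_eq => x; apply/ffunP => i.
rewrite !ffunE /= !ffunE /= invMg permM.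
by rewrite permKV.
Qed.

(** The images of vectors with a single nonzero coordinate determine the element: their position
    gives the permutation, their value the base component. *)
Lemma wreath_act_inj : injective (@wreath_act F L0 l).
Proof.
have [[v vN0] _] := sim0.
move=> w w' ww'.
have E i u : inj_summand (wreath_top w i) (wreath_base w i u) =
             inj_summand (wreath_top w' i) (wreath_base w' i u).
  by rewrite -!wreath_act_inj_summand ww'.
have Etop : wreath_top w = wreath_top w'.
  apply/permP => i; apply/eqP/negPn/negP => ti.
  have := congr1 (fun x : L => x (wreath_top w i)) (E i v).
  rewrite inj_summandE ffunE (negPf ti).
  have [lg _ /bij_inj bg] := algautP (wreath_base w i).
  by rewrite -{1}(lin0 lg) => /bg v0; case/eqP: vN0.
case: w w' ww' E Etop => [b t] [b' t'] /= _ E tt'; rewrite -tt' in E *.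
congr Wreath; apply/ffunP => i; apply: algaut_eq => u.
by have := congr1 (fun x : L => x (t i)) (E i u); rewrite !inj_summandE.
Qed.

Lemma algaut_permutes_summands (f : algaut L) :
  exists s : 'I_l -> 'I_l,
    forall i, f @^-1` (summand (s i)) = @summand F L0 l i.
Proof.
have isof : is_algiso f := algautP f; have [_ _ [g fK gK]] := isof.
have isog := is_algiso_inv isof fK gK.
suff /choice[s fs] :
    forall i, exists j, f @^-1` (summand j) = @summand F L0 l i.
  by exists s.
(* The preimage under [g] is the image under [f], again a minimal ideal and therefore a summand. *)
move=> i; have : range (@summand F L0 l) (g @^-1` summand i).
  rewrite -minimal_idealsE; apply: minimal_ideal_preimage => //.
  rewrite -[minimal_ideal _]/([set I : set L | minimal_ideal I] _).
  by rewrite minimal_idealsE; exists i.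
by move=> [j _ E]; exists j; rewrite E; apply/seteqP; split=> x; rewrite /= fK.
Qed.

Lemma wreath_act_surj (f : algaut L) : exists w, wreath_act w = f.
Proof.
have [lf mf bf] := algautP f.
have [g fK gK] := bf.
have [s fs] := algaut_permutes_summands f.
have s_inj : injective s.
  by move=> i j ij; apply: summand_inj; rewrite -(fs i) -(fs j) ij.
(* The restriction of [f] to the [i]-th summand, read in the summand [s i] where it takes its
   values. *)
pose h i v := f (inj_summand i v) (s i).
have hE i v : inj_summand (s i) (h i v) = f (inj_summand i v).
  rewrite -summandE // -[summand _ _]/((f @^-1` _) _) fs; exact: inj_summandP.
have h_aut i : is_algaut (h i).
  split.
  - by move=> a u v; rewrite /h inj_summand_linear lf !ffunE.
  - by move=> u v; rewrite /h -inj_summand_bracket mf !ffunE.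
  - exists (fun v => g (inj_summand (s i) v) i) => v.
      by rewrite hE fK inj_summandE.
    rewrite /h -summandE ?gK ?inj_summandE //.
    by rewrite -fs /= gK; apply: inj_summandP.
exists (Wreath [ffun i => AlgAut (h_aut i)] (perm s_inj)).
apply: algaut_eq => x; rewrite -(inj_summandK x).
rewrite (lin_sum lf) (lin_sum (algaut_linear _)); apply: eq_bigr => i _.
by rewrite wreath_act_inj_summand /= ffunE permE /= hE.
Qed.

Lemma wreath_act_bij : bijective (@wreath_act F L0 l).
Proof.
have [inv invK] := choice wreath_act_surj.
by exists inv => // w; apply: wreath_act_inj; rewrite invK.
Qed.

Lemma IAC_of_power : (1 <= l)%N -> IAC L -> IAC L0.
Proof.
move=> l_gt0 [_ irrL]; split; first by have [] := sim0.
move=> W sW Winv; pose i0 := Ordinal l_gt0.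
(* The power of [W] is invariant since every automorphism comes from the wreath product. Constant
   families then show that [W] is zero or everything as soon as [Wl] is. *)
pose Wl : set L := [set x | forall i, W (x i)].
have cstl (v : L0) : W v -> Wl [ffun => v] by move=> Wv i; rewrite ffunE.
have [||W0|WT] := irrL Wl.
- split=> [i|a x y Wx Wy i]; first by rewrite ffunE; apply: subspace0.
  by rewrite !ffunE; case: sW => _; apply.
- move=> f x Wx i; have [w <-] := wreath_act_surj f.
  by rewrite ffunE; apply: Winv; apply: Wx.
- left; apply/seteqP; split=> v /=; last by move=> ->; apply: subspace0.
  by move=> /cstl; rewrite W0 => /= /ffunP/(_ i0); rewrite !ffunE.
- right; apply/seteqP; split=> // v _.
  have : Wl [ffun => v] by rewrite WT.
  by move=> /(_ i0); rewrite ffunE.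
Qed.

End NonabelianSimple.

Lemma abelian_power : abelian_alg L0 -> abelian_alg L.
Proof. by move=> ab x y; apply/ffunP => i; rewrite !ffunE ab. Qed.

End PowerAlgebra.

(** * Decomposition of a finite-dimensional IAC algebra *)

(** Take [U] of maximal dimension inside [W]: adding the line of any [x] in [W] cannot enlarge it.
    This makes dimension arguments available for ideals given as sets. *)
Lemma subspace_vspace (F : fieldType) (V : vectType F) (W : set V) :
  is_subspace W -> exists U : {vspace V}, W = [set x | x \in U].
Proof.
move=> sW.
pose P n :=
  `[< exists2 U : {vspace V}, \dim U = n & forall x, x \in U -> W x >].
have exP : exists n, P n.
  exists 0%N; apply/asboolP; exists 0%VS; first exact: dimv0.
  by move=> x; rewrite memv0 => /eqP->; apply: subspace0.
have bound n : P n -> (n <= \dim {:V})%N.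
  by move=> /asboolP[U <- _]; apply: dimvS; apply: subvf.
have [n /asboolP[U dimU UW] Umax] := ex_maxnP exP bound.
exists U; apply/seteqP; split=> x; last exact: UW.
move=> Wx /=; have UxW : P (\dim (U + <[x]>)%VS).
  apply/asboolP; exists (U + <[x]>)%VS => //.
  move=> y /memv_addP[u uU [v /vlineP[a ->] ->]].
  by rewrite addrC; case: sW => _; apply => //; apply: UW.
have UUx : U = (U + <[x]>)%VS.
  by apply/eqP; rewrite eqEdim addvSl dimU Umax.
by rewrite UUx; apply: (subvP (addvSr U _)); apply: memv_line.
Qed.

(** A nonzero ideal of least dimension is minimal; being an ideal, it is closed under the bracket
    and so is a subalgebra. *)
Lemma minimal_ideal_exists (F : fieldType) (L : finDimAnticommAlgType F) :
  (exists x : L, x != 0) -> exists S : subalgebra L,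
    minimal_ideal [set x : L | x \in subalg_vspace S].
Proof.
move=> [x0 x0N0].
pose P n := `[< exists U : {vspace L},
  [/\ \dim U = n, U != 0%VS & is_ideal [set x : L | x \in U]] >].
have exP : exists n, P n.
  exists (\dim {:L}); apply/asboolP; exists {:L}%VS; split=> //.
    by apply: contraNneq x0N0 => L0; rewrite -memv0 -L0 memvf.
  by apply: is_idealP => [|x y _]; [split=> [|a x y _ _] |]; apply: memvf.
have [n /asboolP[U [dimU UN0 iU]] Umin] := ex_minnP exP.
have UM x y : x \in U -> y \in U -> ⟦x, y⟧ \in U.
  by move=> xU _; have [_ /(_ x y xU)[]] := iU.
exists (Subalgebra UM); split=> //=.
  move=> U0; case/eqP: UN0; apply/eqP; rewrite -subv0; apply/subvP => x xU.
  by rewrite memv0; apply/eqP; rewrite -[x = 0]/([set 0] x) -U0.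
move=> J iJ JN0 sJ; have [K JK] := subspace_vspace (proj1 iJ).
rewrite JK in iJ JN0 sJ *; suff -> : K = U by [].
apply/eqP; rewrite eqEdim; apply/andP; split; first exact/subvP.
rewrite dimU; apply: Umin; apply/asboolP; exists K; split=> //.
apply/eqP => K0; apply: JN0; apply/seteqP; split=> x /=; rewrite K0 memv0.
  by move/eqP.
by move=> ->.
Qed.

(** * Sums of automorphic images of a minimal ideal *)

Section Decomposition.
Variables (F : fieldType) (L : finDimAnticommAlgType F) (S : subalgebra L).

Definition subalg_incl (x : S) : L := vsval x.

Lemma subalg_incl_linear : linear subalg_incl. Proof. by []. Qed.

Lemma subalg_incl_inj : injective subalg_incl. Proof. exact: val_inj. Qed.

Lemma subalg_inclP x : subalg_incl x \in subalg_vspace S.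
Proof. exact: subvsP. Qed.

Lemma subalg_inclE x : x \in subalg_vspace S -> exists y, x = subalg_incl y.
Proof. by move=> xS; exists (Subvs xS). Qed.

(** The automorphisms are indexed by [nat], not by ['I_l], so that the type of [f] stays the same
    when [l] grows; only the first [l] values matter. *)
Definition assemble (f : nat -> algaut L) l (v : {ffun 'I_l -> S}) : L :=
  \sum_(i < l) f i (subalg_incl (v i)).

Lemma algaut_incl_linear (f : algaut L) : linear (fun x => f (subalg_incl x)).
Proof. by move=> a x y; rewrite subalg_incl_linear algaut_linear. Qed.

Lemma assemble_linear f l : linear (@assemble f l).
Proof.
move=> a v w; rewrite /assemble scaler_sumr -big_split /=.
apply: eq_bigr => i _.
by rewrite !ffunE algaut_incl_linear.
Qed.

Lemma assemble_inj_summand f l (i : 'I_l) u :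
  assemble f (inj_summand i u) = f i (subalg_incl u).
Proof.
rewrite /assemble (bigD1 i) //= inj_summandE big1 ?addr0 // => j /negPf ji.
by rewrite ffunE ji (lin0 (@algaut_incl_linear (f j))).
Qed.

(** The domain has dimension [l] times that of [S], which is at least [l] because [S] is nonzero. *)
Lemma assemble_injective_bound f l : (exists x : S, x != 0) ->
  injective (@assemble f l) -> (l <= \dim {:L})%N.
Proof.
move=> [x xN0] injf.
pose h : {linear {ffun 'I_l -> S} -> L} := HB.pack (@assemble f l)
  (GRing.isLinear.Build F _ _ *:%R _ (@assemble_linear f l)).
have hI : injective (linfun h) by move=> u v; rewrite !lfunE; apply: injf.
have S_gt0 : (0 < dim S)%N.
  rewrite -dimvf lt0n dimv_eq0; apply: contraNneq xN0 => S0.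
  by rewrite -memv0 -S0 memvf.
have le_h : (\dim {: {ffun 'I_l -> S}} <= \dim {:L})%N.
  rewrite -(@limg_dim_eq _ _ _ (linfun h)) ?dimvS ?subvf //.
  by have /lker0P/eqP-> := hI; rewrite capv0.
apply: leq_trans le_h.
by rewrite dimvf /dim /= card_ord leq_pmulr.
Qed.

Hypothesis mS : minimal_ideal [set x : L | x \in subalg_vspace S].

Lemma minimal_ideal_nonzero : exists x : S, x != 0.
Proof.
have [[sS _] SN0 _] := mS; have [x xS xN0] := subspace_n0 sS SN0.
by exists (Subvs xS).
Qed.

(** The image of [S] under [f] is again an ideal: pull [y] back by the inverse of [f] and bracket
    inside [S]. *)
Lemma algaut_incl_bracket (f : algaut L) (u : S) y :
  exists v : S, ⟦f (subalg_incl u), y⟧ = f (subalg_incl v).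
Proof.
have [[_ iS] _ _] := mS.
have [+ _] := iS _ (f^-1%g y) (subalg_inclP u).
move=> /subalg_inclE[v Ev]; exists v; rewrite -Ev algaut_bracket.
by congr bracket; rewrite [RHS]algaut_inv_funK.
Qed.

Lemma assemble_range_ideal f l : is_ideal (range (@assemble f l)).
Proof.
apply: is_idealP => [|_ y [v _ <-]].
  by apply: (subspace_image (@assemble_linear f l)).
have [w wE] := choice (fun i : 'I_l => algaut_incl_bracket (f i) (v i) y).
exists [ffun i => w i] => //.
rewrite /assemble (lin_sum (bracket_linearl y)); apply: eq_bigr => i _.
by rewrite ffunE wE.
Qed.

(* The elements sent into the range by every automorphism form an invariant
   subspace, so some [g] moves [S] out of the range; the new summand [g S] then
   meets the range in [0] because [S] is minimal. *)
Lemma assemble_extend f l : IAC L -> injective (@assemble f l) ->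
  range (@assemble f l) <> setT ->
  exists f', injective (@assemble f' l.+1).
Proof.
move=> [_ irrL] inj_f RNT; set R := range _ in RNT.
have iR : is_ideal R := assemble_range_ideal f l.
have [g [x [xS gxNR]]] :
    exists (g : algaut L) x, x \in subalg_vspace S /\ ~ R (g x).
  apply: contrapT => nex; apply: RNT.
  have SR x : x \in subalg_vspace S -> forall g : algaut L, R (g x).
    by move=> xS g; apply: contrapT => ?; apply: nex; exists g, x.
  have [||K0|KT] := irrL [set x | forall g : algaut L, R (g x)].
  - split=> [g|a y z Ky Kz g].
      by rewrite (lin0 (algaut_linear g)); apply: subspace0 (proj1 iR).
    by rewrite algaut_linear; case: iR => [[_]] RD _; apply: RD.
  - by move=> h y Ky g; apply: (Ky (h * g)%g).
  - have [y /negP[]] := minimal_ideal_nonzero; apply/eqP/subalg_incl_inj.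
    have := SR _ (subalg_inclP y).
    by rewrite -[X in X -> _]/([set x | forall g : algaut L, R (g x)] _) K0.
  - apply/seteqP; split=> // y _.
    have : [set x | forall g : algaut L, R (g x)] y by rewrite KT.
    by move=> /(_ 1%g).
(* The elements of [S] that [g] sends into [R] form an ideal inside [S]. By minimality it is 0 or
   [S], and [x] excludes the latter. *)
have SgR (u : S) : R (g (subalg_incl u)) -> u = 0.
  move=> Ru; have [iS _ Smin] := mS.
  have iD : is_ideal [set x : L | x \in subalg_vspace S /\ R (g x)].
    have iRg := ideal_preimage (algautP g) iR.
    apply: is_idealP => [|y z [yS Ry]].
      split=> [|a y z [yS Ry] [zS Rz]].
        by split; [exact: mem0v | exact: subspace0 (proj1 iRg)].
      by split; [rewrite rpredD // rpredZ | case: iRg => [[_ RD] _]; apply: RD].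
    by split; [case: iS => _ /(_ y z yS)[] | case: iRg => _ /(_ y z Ry)[]].
  have [D0|DN0] :=
      EM ([set x : L | x \in subalg_vspace S /\ R (g x)] = [set 0]).
    apply: subalg_incl_inj; have : [set 0] (subalg_incl u); last by [].
    by rewrite -D0; split=> //; apply: subalg_inclP.
  case: gxNR; have : [set x : L | x \in subalg_vspace S] x by [].
  by rewrite -(Smin _ iD DN0) => [[]|y []].
exists (fun k => if (k < l)%N then f k else g); apply: lin_inj.
  exact: assemble_linear.
move=> v; rewrite /assemble big_ord_recr /= ltnn.
pose w := [ffun i => v (widen_ord (leqnSn l) i)].
rewrite (eq_bigr (fun i : 'I_l => f i (subalg_incl (w i)))) => [|i _];
  last first.
  by rewrite ltn_ord ffunE.
rewrite -/(assemble f w) => E.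
(* The vanishing sum says that [g] sends the last component to minus an element of [R]. *)
have v0 : v ord_max = 0.
  apply: SgR; exists (- w) => //.
  by apply/esym/eqP; rewrite (linN (@assemble_linear f l)) -addr_eq0 addrC E.
rewrite v0 (lin0 (algaut_incl_linear g)) addr0 in E.
have w0 : w = 0 by apply: inj_f; rewrite E (lin0 (@assemble_linear f l)).
apply/ffunP => i; rewrite [RHS]ffunE.
have [j ->|->//] := unliftP ord_max i.
have := congr1 (fun w : {ffun 'I_l -> S} => w j) w0; rewrite !ffunE => <-.
by congr (v _); apply: val_inj; rewrite /= /bump leqNgt ltn_ord.
Qed.

(** In the double sum only the diagonal terms survive, since injectivity makes distinct summands
    meet in 0. *)
Lemma assemble_bracket f l : injective (@assemble f l) ->
  {morph @assemble f l : v w / ⟦v, w⟧}.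
Proof.
move=> injf v w; rewrite [in RHS]/assemble.
rewrite (lin_sum (bracket_linearl _)); apply: eq_bigr => i _.
rewrite (lin_sum (bracket_linearr _)) (bigD1 i) //= big1 => [|j ji].
  by rewrite addr0 -algaut_bracket ffunE.
have [a Ea] := algaut_incl_bracket (f i) (v i) (f j (subalg_incl (w j))).
have [b Eb] := algaut_incl_bracket (f j) (w j) (f i (subalg_incl (v i))).
(* The bracket of elements of two distinct summands lies in both of them. *)
have ab : inj_summand i a = inj_summand j (- b).
  apply: injf; rewrite !assemble_inj_summand (linN (@algaut_incl_linear (f j))).
  by rewrite -Ea -Eb bracketC.
have a0 : a = 0.
  have := congr1 (fun w : {ffun 'I_l -> S} => w i) ab.
  by rewrite inj_summandE ffunE eq_sym (negPf ji).
by rewrite Ea a0 (lin0 (@algaut_incl_linear (f i))).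
Qed.

Lemma assemble_algiso_exists : IAC L ->
  exists f l, is_algiso (@assemble f l).
Proof.
move=> iacL.
pose P l := `[< exists f, injective (@assemble f l) >].
have exP : exists l, P l.
  (* For [l = 0] the domain has a single element, so any choice of automorphisms works. *)
  exists 0%N; apply/asboolP; exists (fun => 1%g) => v w _.
  by apply/ffunP => [[]].
have bound l : P l -> (l <= \dim {:L})%N.
  by move=> /asboolP[f]; apply: assemble_injective_bound minimal_ideal_nonzero.
have [l /asboolP[f injf] lmax] := ex_maxnP exP bound.
exists f, l; split; [exact: assemble_linear | exact: assemble_bracket |].
have [RT|/(assemble_extend iacL injf) ext] := EM (range (@assemble f l) = setT).
  have : forall y : L, exists x : {ffun 'I_l -> S}, assemble f x = y.
    move=> y; have : range (@assemble f l) y by rewrite RT.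
    by case=> x _ <-; exists x.
  by move=> /choice[h hK]; exists h => // x; apply: injf; rewrite hK.
have /lmax : P l.+1 by apply/asboolP.
by rewrite ltnn.
Qed.

(** An ideal [K] of [S] is an ideal of [L]: bracketing an element of [K] with any [y] in [L] amounts
    to bracketing it with an element of [S]. Minimality of [S] then applies. *)
Lemma minimal_ideal_simple f l (i : 'I_l) : is_algiso (@assemble f l) ->
  simple_alg S.
Proof.
move=> [lf mf [h hK fK]]; split=> [|K iK]; first exact: minimal_ideal_nonzero.
have iK' : is_ideal (subalg_incl @` K).
  apply: is_idealP => [|_ y [k Kk <-]].
    exact: (subspace_image subalg_incl_linear (proj1 iK)).
  (* After applying [f i], the element [k] lies in the [i]-th summand, so only the [i]-th component
     of [f i y] contributes to the bracket. *)
  pose v := h (f i y).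
  exists ⟦k, v i⟧; first by case: iK => _ /(_ k (v i) Kk)[].
  have [_ _ /bij_inj injfi] := algautP (f i); apply: injfi.
  rewrite -assemble_inj_summand algaut_bracket -assemble_inj_summand.
  by rewrite -(fK (f i y)) -mf inj_summand_bracketl.
have [_ _ Smin] := mS.
have [K0|KN0] := EM (subalg_incl @` K = [set 0]); [left | right].
  apply/seteqP; split=> x /=; last by move=> ->; apply: subspace0 (proj1 iK).
  move=> Kx; apply: subalg_incl_inj; have : [set 0] (subalg_incl x); last by [].
  by rewrite -K0; exists x.
apply/seteqP; split=> // x _.
have : (subalg_incl @` K) (subalg_incl x).
  rewrite (Smin _ iK' KN0) /=; first exact: subalg_inclP.
  by move=> _ [y _ <-]; apply: subalg_inclP.
by move=> [y Ky /subalg_incl_inj <-].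
Qed.

End Decomposition.

Theorem theorem4p2 (F : fieldType) :
  (forall (L0 : anticommAlgType F) (l : nat),
      (1 <= l)%N -> simple_alg L0 -> IAC L0 ->
      IAC {ffun 'I_l -> L0} /\
      (~ abelian_alg L0 ->
        [/\ [set I : set {ffun 'I_l -> L0} | minimal_ideal I]
              = range (@summand F L0 l),
            [set I : set {ffun 'I_l -> L0} | minimal_ideal I] #= `I_l,
            {morph @wreath_act F L0 l : u v / (u * v)%g} &
            bijective (@wreath_act F L0 l)])) /\
  (forall L : finDimAnticommAlgType F, IAC L ->
      exists (I : subalgebra L) (l : nat),
        [/\ (1 <= l)%N, simple_alg I, IAC I,
            alg_isomorphic L {ffun 'I_l -> I} &
            ~ abelian_alg L ->
              [set J : set L | minimal_ideal J] #= `I_l]).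
Proof.
split=> [L0 l l_gt0 sim0 iac0|L iacL].
  split=> [|nab0]; first exact: IAC_power.
  split; [exact: minimal_idealsE | exact: card_minimal_ideals |
          exact: wreath_act_morph | exact: wreath_act_bij].
have [[x xN0] _] := iacL.
have [I mI] := minimal_ideal_exists (ex_intro (fun x => x != 0) x xN0).
have [f [l isof]] := assemble_algiso_exists mI iacL.
have [_ _ [h fK hK]] := isof.
have isoh : is_algiso h := is_algiso_inv isof fK hK.
(* For [l = 0] every element of [L] would be an empty sum, contradicting [x != 0]. *)
have l_gt0 : (1 <= l)%N.
  case: l => [|//] in f isof h fK hK isoh *.
  by case/negP: xN0; rewrite -(hK x) /assemble big_ord0.
have simI := minimal_ideal_simple mI (Ordinal l_gt0) isof.
exists I, l; split=> //.
- have [abI|nabI] := EM (abelian_alg I); first exact: abelian_simple_IAC.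
  by apply: (@IAC_of_power _ _ l) => //; apply: IAC_iso isoh iacL.
- by exists h.
- move=> nabL; apply: card_eq_trans (card_minimal_ideal_iso isoh) _.
  (* If [I] were abelian, so would be its power and hence [L]. *)
  apply: card_minimal_ideals => // abI; apply: nabL.
  by apply: abelian_iso isoh _; apply: abelian_power.
Qed.
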